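(* Consider the three-sphere $S^3$ equipped with the standard round metric. There exist non-vanishing stationary solutions $X$ to the Euler equations on $S^3$ such that some $C^0$-neighborhood of $X$ (in the space of smooth divergence-free vector fields on $S^3$) does not contain any rotational Beltrami field.
   Context: A stationary solution to the Euler equations is a (time-independent, smooth) vector field $u$ with $\operatorname{div}u=0$ and $\nabla_u u=-\nabla p$ for some function $p$. With $\mu$ the Riemannian volume form and $u^\flat=g(u,\cdot)$, $\operatorname{curl}u$ is the vector field defined by $\iota_{\operatorname{curl}u}\mu=d(u^\flat)$. A rotational Beltrami field is a divergence-free vector field $X$ such that $\operatorname{curl}X=fX$ for some nowhere-vanishing function $f\in C^\infty(S^3)$. *)

(* Defs.v *)
(* MathComp-Analysis.  The sphere S^3 is the unit sphere of Euclidean R^4, with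
   the metric induced by [dot].  A function (or tensor field) on S^3 is given by
   a function on R^4 of which only the values on S^3 are ever used. *)
From HB Require Import structures.
From mathcomp Require Import all_boot all_order all_algebra.
From mathcomp Require Import all_classical all_reals all_analysis.

Set Implicit Arguments.
Unset Strict Implicit.
Unset Printing Implicit Defensive.

Import Order.TTheory GRing.Theory Num.Theory.
Import numFieldNormedType.Exports.

Local Open Scope classical_set_scope.
Local Open Scope ring_scope.

Definition dot (R : realType) (u v : 'rV[R]_4) : R := \sum_i u 0 i * v 0 i.

(* The library norm on 'rV[R]_4 is the sup norm, hence this Euclidean one. *)
Definition enorm (R : realType) (u : 'rV[R]_4) : R := Num.sqrt (dot u u).

Definition S3 (R : realType) : set 'rV[R]_4 := [set x | enorm x = 1].

Definition tangent (R : realType) (x v : 'rV[R]_4) : Prop := dot x v = 0.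

Definition tproj (R : realType) (x v : 'rV[R]_4) : 'rV[R]_4 :=
  v - dot x v *: x.

Fixpoint Ck_on (R : realType) (W : normedModType R) (k : nat)
    (U : set 'rV[R]_4) (F : 'rV[R]_4 -> W) : Prop :=
  match k with
  | 0%N => forall x, U x -> {for x, continuous F}
  | k'.+1 => (forall x, U x -> differentiable F x) /\
             (forall v, Ck_on k' U (fun x => 'd F x v))
  end.

(* Smoothness on a subset of R^4: local extendability to smooth maps. *)
Definition smooth_S3 (R : realType) (W : normedModType R)
    (f : 'rV[R]_4 -> W) : Prop :=
  forall x, S3 x -> exists (U : set 'rV[R]_4) (F : 'rV[R]_4 -> W),
    [/\ open U, U x, forall k, Ck_on k U F &
        forall y, U y -> S3 y -> F y = f y].

Definition retr (R : realType) (x : 'rV[R]_4) : 'rV[R]_4 :=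
  (enorm x)^-1 *: x.

(* Derivative of f at x in S^3 in the direction v tangent to S^3 at x, i.e.
   along the curve t |-> (x + t v) / |x + t v| of S^3, whose velocity at t = 0
   is v. *)
Definition tderiv (R : realType) (W : normedModType R)
    (f : 'rV[R]_4 -> W) (x v : 'rV[R]_4) : W :=
  'D_v (f \o @retr R) x.

Definition smooth_field (R : realType) (u : 'rV[R]_4 -> 'rV[R]_4) : Prop :=
  smooth_S3 u /\ forall x, S3 x -> tangent x (u x).

(* nabla_v u at x, for v tangent at x: the Levi-Civita connection of a
   submanifold of Euclidean space is the tangential part of the ambient
   derivative. *)
Definition nabla (R : realType) (u : 'rV[R]_4 -> 'rV[R]_4)
    (x v : 'rV[R]_4) : 'rV[R]_4 :=
  tproj x (tderiv u x v).

(* Trace of the endomorphism v |-> nabla_v u of the tangent space at x, computed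
   as the trace on R^4 of its composition with the orthogonal projection. *)
Definition divergence (R : realType) (u : 'rV[R]_4 -> 'rV[R]_4)
    (x : 'rV[R]_4) : R :=
  \sum_(i < 4) dot (delta_mx 0 i) (nabla u x (tproj x (delta_mx 0 i))).

Definition is_gradient (R : realType) (p : 'rV[R]_4 -> R)
    (g : 'rV[R]_4 -> 'rV[R]_4) : Prop :=
  forall x, S3 x -> tangent x (g x) /\
    forall v, tangent x v -> dot (g x) v = tderiv (p : 'rV[R]_4 -> R^o) x v.

(* Riemannian volume form, S^3 being oriented as the boundary of the ball. *)
Definition vol (R : realType) (x a b c : 'rV[R]_4) : R :=
  \det (\matrix_(i < 4) nth 0 [:: x; a; b; c] i).

Definition flat (R : realType) (u : 'rV[R]_4 -> 'rV[R]_4)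
    (x v : 'rV[R]_4) : R := dot (u x) v.

(* Exterior derivative at x, evaluated on tangent vectors a and b, of the 1-form
   on S^3 obtained by restricting each linear form [alpha y] on R^4 to the
   tangent space at y.  Computed on the extension of alpha to R^4 \ {0} by
   y |-> alpha (retr y); the choice of the values of alpha on normal vectors is
   immaterial since pullback to S^3 commutes with the exterior derivative. *)
Definition ext_d (R : realType) (alpha : 'rV[R]_4 -> 'rV[R]_4 -> R)
    (x a b : 'rV[R]_4) : R :=
  tderiv ((fun y => alpha y b) : 'rV[R]_4 -> R^o) x a -
  tderiv ((fun y => alpha y a) : 'rV[R]_4 -> R^o) x b.

Definition is_curl (R : realType) (u w : 'rV[R]_4 -> 'rV[R]_4) : Prop :=
  forall x, S3 x -> tangent x (w x) /\
    forall a b, tangent x a -> tangent x b ->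
      vol x (w x) a b = ext_d (flat u) x a b.

Definition div_free_field (R : realType) (u : 'rV[R]_4 -> 'rV[R]_4) : Prop :=
  smooth_field u /\ forall x, S3 x -> divergence u x = 0.

Definition stationary_euler (R : realType) (u : 'rV[R]_4 -> 'rV[R]_4) : Prop :=
  div_free_field u /\
  exists (p : 'rV[R]_4 -> R) (g : 'rV[R]_4 -> 'rV[R]_4),
    [/\ smooth_S3 (p : 'rV[R]_4 -> R^o), is_gradient p g &
        forall x, S3 x -> nabla u x (u x) = - g x].

Definition non_vanishing (R : realType) (u : 'rV[R]_4 -> 'rV[R]_4) : Prop :=
  forall x, S3 x -> u x != 0.

Definition rotational_beltrami (R : realType)
    (u : 'rV[R]_4 -> 'rV[R]_4) : Prop :=
  div_free_field u /\
  exists f : 'rV[R]_4 -> R,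
    [/\ smooth_S3 (f : 'rV[R]_4 -> R^o), forall x, S3 x -> f x != 0 &
        is_curl u (fun x => f x *: u x)].

(* N is a neighborhood of u for the C^0 topology on the space of smooth
   divergence-free vector fields of S^3. *)
Definition C0_nbhd (R : realType) (u : 'rV[R]_4 -> 'rV[R]_4)
    (N : set ('rV[R]_4 -> 'rV[R]_4)) : Prop :=
  N `<=` @div_free_field R /\
  exists2 e : R, 0 < e &
    forall v, div_free_field v ->
      (forall x, S3 x -> enorm (v x - u x) < e) -> N v.

(* Main.v *)
From HB Require Import structures.
From mathcomp Require Import all_boot all_order all_algebra.
From mathcomp Require Import all_classical all_reals all_analysis.
From mathcomp Require Import ring lra.
Require Import Defs.

(** Write a point of S^3 as (z1, z2), with z1 = x0 + i x1 and z2 = x2 + i x3.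
    The field is the shear flow X = (i z1, b i z2), with b = 2 |z2|^2 - 1.  The
    rotations of z1 and of z2 are commuting isometries, X is a combination of
    their generators, and its coefficients depend on |z2|^2 only.  Hence X is
    divergence free, and nabla_X X is the gradient of a function of |z2|^2: X is
    a stationary solution.  It vanishes nowhere.

    The point of the choice is that b is 1 on the circle z1 = 0 and -1 on the
    circle z2 = 0. Cut the circle z1 = 0 by a small square in the direction of
    the z1-plane, and the circle z2 = 0 by a small square in the direction of
    the z2-plane. X is transverse to both squares. Orient them by X: then the
    circulation of X along the boundary of the first one is positive, and
    along the boundary of the second one it is negative. All this persists for
    a field Y that is C^0-close to X. If curl Y = f Y, then by Stokes the
    circulation along the boundary of a square is the integral over the square
    of f times the flux of Y, so f is positive somewhere on the first square
    and negative somewhere on the second one ([factor_positive_somewhere],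
    [factor_negative_somewhere]). On the connected space S^3 a continuous f
    cannot do this without vanishing ([factor_keeps_sign]).

    Only the sign is needed in Stokes, and it comes without integrals.  Cut the
    square into n^2 cells and add up the discrete circulations of the cells:
    the interior edges cancel, so the total is a boundary term, and some cell
    has at least the average.  As n grows such cells accumulate, by compactness,
    at a point where the curl is at least the average ([discrete_green]); this
    uses the fact that difference quotients of a C^1 function converge locally
    uniformly ([strict_derive_lt]).

    The squares are taken in affine planes of R^4, and Y is extended to
    R^4 \ {0} by G = Y o retr, constant on rays.  The curl of G in such a plane
    is the exterior derivative of the 1-form of Y on the sphere up to terms of
    order zero in Y ([curl_ext]), which are small on small squares. *)

Set Implicit Arguments.
Unset Strict Implicit.
Unset Printing Implicit Defensive.

Import Order.TTheory GRing.Theory Num.Theory.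
Import numFieldNormedType.Exports.

Local Open Scope classical_set_scope.
Local Open Scope ring_scope.

(** * Differentials and local equality *)

Section LocalCalculus.
Context {R : realType} {V W : normedModType R}.
Implicit Types (f g : V -> W) (x v : V).

Lemma is_diff_ex f (df : V -> W) x : is_diff x f df -> differentiable f x.
Proof. by case. Qed.

Lemma is_diff_val f (df : V -> W) x v : is_diff x f df -> 'd f x v = df v.
Proof. by case=> _ ->. Qed.

(** The differential is defined by a choice, so that its locality is not
    immediate: it holds because the differential is determined by the first
    order expansion. *)
Lemma near_eq_is_diff f g (df : {linear V -> W}) x :
  {near x, f =1 g} -> is_diff x f df -> is_diff x g df.
Proof.
move=> fg fx.
have fd := is_diff_ex fx.
have dfE : 'd f x = df :> (V -> W) by apply/funext => v; exact: is_diff_val.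
have dfc : continuous df by rewrite -dfE; exact: diff_continuous.
have gE : g \o shift x = cst (g x) + df +o_ 0 id.
  have := diff_locally fd; rewrite dfE => /eqaddoP fE.
  apply/eqaddoP => e e0; have {}fE := fE e e0.
  have fg0 : \forall h \near 0, f (h + x) = g (h + x).
    have := fg; rewrite (near_shift 0 x) => fg'.
    by apply: filterS fg' => h /=; rewrite subr0.
  apply: filterS2 fE fg0 => h /= + fgh.
  by rewrite !fctE -fgh -(nbhs_singleton fg).
have dgE := diff_unique dfc gE.
by apply: DiffDef => //; apply/diff_locallyP; rewrite dgE.
Qed.

Lemma near_eq_differentiable f g x :
  {near x, f =1 g} -> differentiable f x -> differentiable g x.
Proof.
by move=> fg fx; have [] := near_eq_is_diff fg (differentiableP fx).
Qed.

Lemma near_eq_diff f g x : {near x, f =1 g} -> differentiable f x ->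
  'd g x = 'd f x :> (V -> W).
Proof.
by move=> fg fx; have [] := near_eq_is_diff fg (differentiableP fx).
Qed.

End LocalCalculus.

Lemma near_eq_continuous {T U : topologicalType} (f g : T -> U) (x : T) :
  {near x, f =1 g} -> {for x, continuous f} -> {for x, continuous g}.
Proof.
move=> fg fx; rewrite /prop_for /continuous_at -(nbhs_singleton fg).
exact: cvg_trans (near_eq_cvg fg) fx.
Qed.

(** The mean value theorem turns the continuity of the derivative in the
    direction a into an estimate of increments that is uniform in the base
    point. *)
Lemma strict_derive_lt {R : realType} {V : normedModType R} (g : V -> R)
    (x a : V) (c : R) :
  (\forall y \near x, derivable g y a) ->
  {for x, continuous ('D_a g)} -> 'D_a g x < c ->
  \forall y \near x & h \near 0^'+, g (y + h *: a) - g y < c * h.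
Proof.
move=> gd gc gx.
have near1 : \forall y \near x, derivable g y a /\ 'D_a g y < c.
  near=> y; split; first by near: y.
  near: y; have := gc _ (lt_nbhsl gx); exact.
have near2 : \forall p \near (x, (0 : R)),
    derivable g (p.1 + p.2 *: a) a /\ 'D_a g (p.1 + p.2 *: a) < c.
  have cf : {for (x, (0:R)), continuous (fun p : V * R => p.1 + p.2 *: a)}.
    apply: cvgD; first exact: cvg_fst.
    by apply: cvgZr_tmp; exact: cvg_snd.
  have := cf (fun y => derivable g y a /\ 'D_a g y < c).
  by rewrite /= scale0r addr0; apply.
have [[U Z] /= [Ux Z0] UZ] := near2.
have [/= e e0 eZ] := Z0.
exists (U, [set h | 0 < h < e]) => /=.
  split=> //; near=> h; apply/andP; split; near: h.
    exact: nbhs_right_gt.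
  exact: nbhs_right_lt.
move=> [y h] /= [Uy /andP[h0 he]].
have P t : 0 <= t <= h -> derivable g (y + t *: a) a /\ 'D_a g (y + t *: a) < c.
  move=> /andP[t0 th]; apply: (UZ (y, t)); split => //=; apply: eZ.
  by rewrite /= sub0r normrN ger0_norm// (le_lt_trans th he).
pose k t := g (y + t *: a).
have kd t : 0 <= t <= h -> is_derive t (1:R) k ('D_a g (y + t *: a)).
  move=> /P [gd' _].
  have E : (fun r : R => r^-1 *: ((k \o shift t) (r *: (1:R)) - k t)) =
           (fun r : R =>
              r^-1 *: ((g \o shift (y + t *: a)) (r *: a) - g (y + t *: a))).
    apply/funext => r; rewrite /k /=; congr (_ *: (g _ - _)).
    by rewrite [r *: _]mulr1 scalerDl addrCA.
  by apply: DeriveDef; rewrite /derivable /derive E.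
have [| |u] := @MVT R k (fun t => 'D_a g (y + t *: a)) 0 h h0.
- move=> t; rewrite in_itv /= => /andP[t0 th].
  by apply: kd; rewrite !ltW.
- apply: derivable_within_continuous => t; rewrite in_itv/= => th.
  by have [] := kd t th.
rewrite in_itv /= => /andP[u0 uh].
rewrite /k scale0r addr0 subr0 => ->.
by rewrite ltr_pM2r//; apply: (P u _).2; rewrite !ltW.
Unshelve. all: by end_near.
Qed.

(** * Green's inequality by telescoping sums *)

(** Between opposite sides of the square [-e, e]^2, Q increases in u and P
    decreases in v at least as much as for the form (c / 2) (u dv - v du), of
    curl c; so P du + Q dv has somewhere curl at least c. The conclusion is
    phrased with the discrete curl of the cells near (u, v). Otherwise, by
    compactness, all cells of a sufficiently fine grid would have a discrete
    curl below c, contradicting the sum over the grid, in which the interior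
    edges cancel. *)
Lemma discrete_green {R : realType} (P Q : R -> R -> R) (e c : R) :
  0 < e ->
  (forall v, -e <= v <= e -> c * e <= Q e v - Q (- e) v) ->
  (forall u, -e <= u <= e -> c * e <= P u (- e) - P u e) ->
  exists u v, [/\ -e <= u <= e, -e <= v <= e &
    ~ (\forall p \near (u, v) & h \near 0^'+,
         (Q (p.1 + h) p.2 - Q p.1 p.2) -
         (P p.1 (p.2 + h) - P p.1 p.2) < c * h)].
Proof.
move=> e0 HQ HP; apply: contrapT => nex.
pose K : set (R * R) := `[- e, e] `*` `[- e, e].
have cK : compact K by apply: compact_setX; exact: segment_compact.
have /compact_near_coveringP nK := cK.
pose S h (p : R * R) :=
  (Q (p.1 + h) p.2 - Q p.1 p.2) - (P p.1 (p.2 + h) - P p.1 p.2) < c * h.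
(* a threshold for the mesh that is uniform over the square *)
have hS : \forall h \near 0^'+, K `<=` S h.
  apply: nK => -[u v] [/=]; rewrite !in_itv /= => uK vK.
  by apply: contrapT => nS; apply: nex; exists u, v.
have [/= d d0 dS] := hS.
have [n n0 nd] : exists2 n : nat, 0 < n%:R :> R & 2 * e / d < n%:R.
  by exists (Num.trunc (2 * e / d)).+1; rewrite ?ltr0n//; exact: truncnS_gt.
have n0' : (0 < n)%N by rewrite -(ltr0n R).
pose h := 2 * e / n%:R.
have h0 : 0 < h by rewrite divr_gt0 ?mulr_gt0.
have hd : h < d by rewrite /h ltr_pdivrMr// [d * _]mulrC -ltr_pdivrMr.
have {}hS : K `<=` S h by apply: dS; rewrite //= sub0r normrN gtr0_norm.
have nh : n%:R * h = 2 * e by rewrite /h mulrC divfK// gt_eqF.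
pose w (i : nat) := - e + i%:R * h.
have w0 : w 0%N = - e by rewrite /w mul0r addr0.
have wn : w n = e by rewrite /w nh; ring.
have wS i : w i.+1 = w i + h by rewrite /w -natr1; ring.
have wK i : (i <= n)%N -> - e <= w i <= e.
  move=> lin; rewrite -[X in _ <= _ <= X]wn /w lerDl lerD2l.
  rewrite mulr_ge0 ?ler0n//=; last exact: ltW.
  by rewrite ler_pM2r// ler_nat.
pose A i j := Q (w i.+1) (w j) - Q (w i) (w j).
pose B i j := P (w i) (w j.+1) - P (w i) (w j).
have cell i j : (i < n)%N -> (j < n)%N -> A i j - B i j < c * h.
  move=> lin ljn; rewrite /A /B !wS; apply: (hS (w i, w j)).
  by split; rewrite /= in_itv/= wK// ltnW.
have upper : \sum_(0 <= i < n) \sum_(0 <= j < n) (A i j - B i j) <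
             \sum_(0 <= i < n) \sum_(0 <= j < n) c * h.
  apply: ltr_sum_nat => // i /andP[_ lin].
  by apply: ltr_sum_nat => // j /andP[_ ljn]; exact: cell.
have telA j : \sum_(0 <= i < n) A i j = Q e (w j) - Q (- e) (w j).
  by rewrite (telescope_sumr (fun i => Q (w i) (w j)))// wn w0.
have telB i : \sum_(0 <= j < n) B i j = P (w i) e - P (w i) (- e).
  by rewrite (telescope_sumr (fun j => P (w i) (w j)))// wn w0.
have sums : \sum_(0 <= i < n) \sum_(0 <= j < n) (A i j - B i j) =
   \sum_(0 <= j < n) (Q e (w j) - Q (- e) (w j)) +
   \sum_(0 <= i < n) (P (w i) (- e) - P (w i) e).
  under eq_bigr do rewrite sumrB telB.
  rewrite sumrB exchange_big_nat /=; under eq_bigr do rewrite telA.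
  by rewrite -sumrN; congr (_ + _); apply: eq_bigr => i _; rewrite opprB.
have lower : \sum_(0 <= k < n) c * e + \sum_(0 <= k < n) c * e <=
    \sum_(0 <= i < n) \sum_(0 <= j < n) (A i j - B i j).
  rewrite sums; apply: lerD; apply: ler_sum_nat => k /andP[_ kn].
    by apply: HQ; rewrite wK// ltnW.
  by apply: HP; rewrite wK// ltnW.
have := le_lt_trans lower upper.
have sumc (z : R) : \sum_(0 <= k < n) z = n%:R * z.
  by rewrite sumr_const_nat subn0 mulr_natl.
rewrite !sumc.
have -> : n%:R * (n%:R * (c * h)) = n%:R * c * (n%:R * h) by ring.
by rewrite nh; set k := n%:R; nra.
Qed.

(** * Euclidean geometry of R^4 and radial projection *)

Section RowMaps.
Context {R : realType} {V : normedModType R} {n : nat}.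

Lemma is_diff_row (f df : V -> 'rV[R]_n.+1) (x : V) :
  (forall i, is_diff x (fun y => f y 0 i : R) (fun v => df v 0 i)) ->
  is_diff x f df.
Proof.
move=> H.
have fE : f = \sum_i (fun y => f y 0 i *: 'e_i).
  by apply/funext => y; rewrite fct_sumE {1}[f y]row_sum_delta.
have di i : differentiable (fun y => f y 0 i *: 'e_i : 'rV[R]_n.+1) x.
  by apply: differentiableZl; have [] := H i.
have df' : differentiable f x by rewrite fE; exact: differentiable_sum.
apply: DiffDef => //; apply/funext => v.
have := deriveE v df'; rewrite {1}fE derive_sum; last first.
  by move=> i; exact: diff_derivable.
move=> <-; rewrite [RHS]row_sum_delta; apply: eq_bigr => i _.
rewrite deriveE// diffZl; last by have [] := H i.
by have [_ ->] := H i.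
Qed.

Lemma is_diff_coord (x : 'rV[R]_n.+1) i :
  is_diff x (fun y : 'rV[R]_n.+1 => y 0 i : R) (fun v => v 0 i).
Proof.
have @f : {linear 'rV[R]_n.+1 -> R}.
  by exists (fun N : 'rV[R]_n.+1 => N 0 i); do 2![eexists]; do ?[constructor];
     rewrite ?mxE// => ? *; rewrite ?mxE//; move=> ?; rewrite !mxE.
have fc : continuous f by exact: coord_continuous.
have -> : (fun y : 'rV[R]_n.+1 => y 0 i) = f by [].
by apply: DiffDef; [exact: linear_differentiable|exact: diff_lin].
Qed.

End RowMaps.

Section Euclidean.
Context {R : realType}.
Implicit Types (x y u v w a b : 'rV[R]_4).

Lemma ord4P (P : 'I_4 -> Prop) : P 0 -> P 1 -> P 2 -> P 3 -> forall i, P i.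
Proof.
move=> P0 P1 P2 P3 [[|[|[|[|//]]]] i4]; [move: P0|move: P1|move: P2|move: P3];
  by congr P; exact: val_inj.
Qed.

Lemma big_ord4 (V : zmodType) (F : 'I_4 -> V) :
  \sum_i F i = F 0 + F 1 + F 2 + F 3.
Proof.
rewrite !big_ord_recl big_ord0 addr0 !addrA.
by congr (_ + F _ + F _ + F _); exact: val_inj.
Qed.

Lemma dotE u v :
  dot u v = u 0 0 * v 0 0 + u 0 1 * v 0 1 + u 0 2 * v 0 2 + u 0 3 * v 0 3.
Proof. by rewrite /dot big_ord4. Qed.

Lemma dotC u v : dot u v = dot v u.
Proof. by rewrite !dotE; ring. Qed.

Lemma dotDl u v w : dot (u + v) w = dot u w + dot v w.
Proof. by rewrite !dotE !mxE; ring. Qed.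

Lemma dotZl k u w : dot (k *: u) w = k * dot u w.
Proof. by rewrite !dotE !mxE; ring. Qed.

Lemma dotDr u v w : dot w (u + v) = dot w u + dot w v.
Proof. by rewrite !dotE !mxE; ring. Qed.

Lemma dotZr k u w : dot w (k *: u) = k * dot w u.
Proof. by rewrite !dotE !mxE; ring. Qed.

Lemma dotBr u v w : dot w (u - v) = dot w u - dot w v.
Proof. by rewrite !dotE !mxE; ring. Qed.

Lemma dot_delta u i : dot u 'e_i = u 0 i.
Proof.
rewrite /dot (bigD1 i)//= big1 ?addr0 ?mxE ?eqxx ?mulr1//.
by move=> j ji; rewrite mxE (negbTE ji) andbF mulr0.
Qed.

Lemma dot_ge0 u : 0 <= dot u u.
Proof. by rewrite dotE; nra. Qed.

Lemma dot_eq0 u : (dot u u == 0) = (u == 0).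
Proof.
apply/eqP/eqP => [|->]; last by rewrite dotE !mxE; ring.
move=> u0; apply/rowP => i; rewrite mxE; apply/eqP; rewrite -sqrf_eq0 expr2.
apply/eqP/le_anti; rewrite sqr_ge0 andbT -u0 /dot (bigD1 i)//= lerDl.
by apply: sumr_ge0 => j _; exact: sqr_ge0.
Qed.

Lemma enorm_gt0 u : u != 0 -> 0 < enorm u.
Proof. by move=> u0; rewrite sqrtr_gt0 lt0r dot_eq0 u0 dot_ge0. Qed.

Lemma enorm_sqr u : enorm u * enorm u = dot u u.
Proof. by rewrite -expr2 sqr_sqrtr ?dot_ge0. Qed.

Lemma S3P x : S3 x <-> dot x x = 1.
Proof.
rewrite /S3 /= /enorm; split=> [x1|->]; last exact: sqrtr1.
by rewrite -enorm_sqr /enorm x1 mulr1.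
Qed.

Lemma S3_neq0 x : S3 x -> x != 0.
Proof. by move/S3P => x1; rewrite -dot_eq0 x1 oner_eq0. Qed.

Lemma retr_S3 x : x != 0 -> S3 (retr x).
Proof.
move=> x0; apply/S3P; rewrite /retr dotZl dotZr -enorm_sqr.
by field; rewrite gt_eqF// enorm_gt0.
Qed.

Lemma retr_id x : S3 x -> retr x = x.
Proof. by rewrite /S3 /retr /= => ->; rewrite invr1 scale1r. Qed.

Lemma enormZ k x : 0 <= k -> enorm (k *: x) = k * enorm x.
Proof.
move=> k0; rewrite /enorm dotZl dotZr mulrA -expr2 sqrtrM ?sqr_ge0//.
by rewrite sqrtr_sqr ger0_norm.
Qed.

Lemma retrZ k x : 0 < k -> retr (k *: x) = retr x.
Proof.
move=> k0; rewrite /retr enormZ ?ltW// invfM scalerA mulrAC mulVf ?mul1r//.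
by rewrite gt_eqF.
Qed.

Lemma coord_le_enorm u i : `|u 0 i| <= enorm u.
Proof.
rewrite -sqrtr_sqr ler_sqrt ?dot_ge0// /dot (bigD1 i)//= lerDl.
by apply: sumr_ge0 => j _; exact: sqr_ge0.
Qed.

Lemma is_diff_dot (V : normedModType R) (f g df dg : V -> 'rV[R]_4) (x : V) :
  is_diff x f df -> is_diff x g dg ->
  is_diff x (fun z => dot (f z) (g z) : R)
    (fun h => dot (df h) (g x) + dot (f x) (dg h)).
Proof.
move=> fx gx.
have Hf i := is_diff_comp fx (is_diff_coord (f x) i).
have Hg i := is_diff_comp gx (is_diff_coord (g x) i).
pose c i := (fun y : 'rV[R]_4 => y 0 i : R).
have -> : (fun z => dot (f z) (g z)) = (c 0 \o f) * (c 0 \o g) +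
  (c 1 \o f) * (c 1 \o g) + (c 2 \o f) * (c 2 \o g) + (c 3 \o f) * (c 3 \o g).
  by apply/funext => z; rewrite dotE.
apply: is_diff_eq; apply/funext => v.
by rewrite !dotE !fctE /c /GRing.scale /=; ring.
Qed.

Lemma is_diff_dotl w x : is_diff x (fun y => dot y w : R) (fun v => dot v w).
Proof.
have := is_diff_dot (is_diff_id x) (is_diff_cst w x).
move=> /is_diff_eq; apply; apply/funext => v /=.
by rewrite -[X in dot x X](scale0r w) dotZr mul0r addr0.
Qed.

Lemma is_diff_sqnorm x :
  is_diff x (fun y => dot y y : R) (fun v => 2 * dot x v).
Proof.
have := is_diff_dot (is_diff_id x) (is_diff_id x).
by move=> /is_diff_eq; apply; apply/funext => v /=; rewrite (dotC v); ring.
Qed.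

Lemma is_diff_enorm x : x != 0 ->
  is_diff x (@enorm R) (fun v => (enorm x)^-1 * dot x v).
Proof.
move=> x0; have n0 := enorm_gt0 x0.
have d0 : 0 < dot x x by rewrite -enorm_sqr mulr_gt0.
have ds : is_diff (dot x x) (@Num.sqrt R)
    (fun h => h * (2 * Num.sqrt (dot x x))^-1).
  have [sd sE] := is_derive1_sqrt d0.
  by apply: DiffDef; [exact/derivable1_diffP|rewrite deriv1E// derive1E sE].
have := is_diff_comp (is_diff_sqnorm x) ds.
move=> /is_diff_eq; apply; apply/funext => v /=; rewrite -/(enorm x).
by field; rewrite gt_eqF.
Qed.

Lemma is_diff_retr x : x != 0 ->
  is_diff x (@retr R) (fun v => (enorm x)^-1 *: tproj (retr x) v).
Proof.
move=> x0; have n0 := enorm_gt0 x0; have n1 : enorm x != 0 by rewrite gt_eqF.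
apply: is_diff_row => i.
have H := @is_diff_coord R 3 x i.
have He := is_diff_enorm x0.
have Hi : is_diff x (fun y => (enorm y)^-1)
    (- (enorm x)^-2 *: (fun v => (enorm x)^-1 * dot x v)).
  apply: DiffDef; first by apply: differentiableV => //; exact: is_diff_ex He.
  by rewrite diffV// ?diff_val//; exact: is_diff_ex He.
have -> : (fun y => retr y 0 i) = (fun y => (enorm y)^-1) * (fun y => y 0 i).
  by apply/funext => y; rewrite !mxE.
apply: is_diff_eq; apply/funext => v.
rewrite !fctE !mxE /GRing.scale /= dotZl.
by field.
Qed.

Lemma continuous_enorm : continuous (@enorm R).
Proof.
move=> x; apply: (@continuous_comp _ _ _ (fun y => dot y y) Num.sqrt).
  exact/differentiable_continuous/(is_diff_ex (is_diff_sqnorm x)).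
exact: sqrt_continuous.
Qed.

Lemma is_diff_retr_comp (W : normedModType R) (F : 'rV[R]_4 -> W) y :
  y != 0 -> differentiable F (retr y) ->
  is_diff y (F \o @retr R)
    (fun v => (enorm y)^-1 *: 'd F (retr y) (tproj (retr y) v)).
Proof.
move=> y0 dF; have := is_diff_comp (is_diff_retr y0) (differentiableP dF).
by move=> /is_diff_eq; apply; apply/funext => v /=; rewrite linearZ.
Qed.

(** On S^3 the differential of the radial projection is the orthogonal
    projection to the tangent space. *)
Lemma tderivE (W : normedModType R) (F : 'rV[R]_4 -> W) x v :
  S3 x -> differentiable F x -> tderiv F x v = 'd F x (tproj x v).
Proof.
move=> xS dF; have x0 := S3_neq0 xS; rewrite /tderiv.
have [d dE] : is_diff x (F \o @retr R)
    (fun v => (enorm x)^-1 *: 'd F (retr x) (tproj (retr x) v)).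
  by apply: is_diff_retr_comp => //; rewrite retr_id.
by rewrite deriveE// dE retr_id// xS invr1 scale1r.
Qed.

End Euclidean.

(** * The volume form *)

Section Vol.
Context {R : realType}.
Implicit Types (x y u v w a b : 'rV[R]_4).

(** Laplace expansion along the first two rows.  The entries are indexed by nat
    so that the row and column indices produced by cofactors compute. *)
Lemma det4 (M : nat -> nat -> R) : \det (\matrix_(i < 4, j < 4) M i j) =
  let m2 i j k l := M i k * M j l - M i l * M j k in
  m2 0 1 0 1 * m2 2 3 2 3 - m2 0 1 0 2 * m2 2 3 1 3 + m2 0 1 0 3 * m2 2 3 1 2
  + m2 0 1 1 2 * m2 2 3 0 3 - m2 0 1 1 3 * m2 2 3 0 2 + m2 0 1 2 3 * m2 2 3 0 1.
Proof.
rewrite (expand_det_row _ ord0) !big_ord_recl big_ord0 /cofactor.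
rewrite !(expand_det_row _ ord0) !big_ord_recl !big_ord0 /cofactor.
rewrite !(expand_det_row _ ord0) !big_ord_recl !big_ord0 /cofactor.
rewrite !det_mx11 !mxE /= /bump /= !(addn0, add0n, addn1, add1n) /=.
ring.
Qed.

Lemma volE x w a b : vol x w a b =
  (x 0 0 * w 0 1 - x 0 1 * w 0 0) * (a 0 2 * b 0 3 - a 0 3 * b 0 2)
- (x 0 0 * w 0 2 - x 0 2 * w 0 0) * (a 0 1 * b 0 3 - a 0 3 * b 0 1)
+ (x 0 0 * w 0 3 - x 0 3 * w 0 0) * (a 0 1 * b 0 2 - a 0 2 * b 0 1)
+ (x 0 1 * w 0 2 - x 0 2 * w 0 1) * (a 0 0 * b 0 3 - a 0 3 * b 0 0)
- (x 0 1 * w 0 3 - x 0 3 * w 0 1) * (a 0 0 * b 0 2 - a 0 2 * b 0 0)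
+ (x 0 2 * w 0 3 - x 0 3 * w 0 2) * (a 0 0 * b 0 1 - a 0 1 * b 0 0).
Proof.
have -> : vol x w a b =
    \det (\matrix_(i < 4, j < 4) (nth 0 [:: x; w; a; b] i) 0 (inord j)).
  by rewrite /vol; congr (\det _); apply/matrixP => i j; rewrite !mxE inord_val.
rewrite (det4 (fun i j => (nth 0 [:: x; w; a; b] i) 0 (inord j))) /=.
have -> : inord 0 = 0 :> 'I_4 by exact/val_inj/inordK.
have -> : inord 1 = 1 :> 'I_4 by exact/val_inj/inordK.
have -> : inord 2 = 2 :> 'I_4 by exact/val_inj/inordK.
by have -> : inord 3 = 3 :> 'I_4 by exact/val_inj/inordK.
Qed.

Lemma vol_scale x w a b k : vol x (k *: w) a b = k * vol x w a b.
Proof. by rewrite !volE !mxE; ring. Qed.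

(** Projecting adds multiples of the first row of the determinant. *)
Lemma vol_tproj x w a b : vol x w (tproj x a) (tproj x b) = vol x w a b.
Proof. by rewrite !volE !mxE; ring. Qed.

Lemma vol01 x w : vol x w 'e_0 'e_1 = x 0 2 * w 0 3 - x 0 3 * w 0 2.
Proof. by rewrite volE !mxE /=; ring. Qed.

Lemma vol32 x w : vol x w 'e_3 'e_2 = - (x 0 0 * w 0 1 - x 0 1 * w 0 0).
Proof. by rewrite volE !mxE /=; ring. Qed.

End Vol.

(** * Fields on the sphere extended to be constant on rays *)

Section SmoothFields.
Context {R : realType}.
Implicit Types (x y u v w a b : 'rV[R]_4).

Lemma continuous_retr y : y != 0 -> {for y, continuous (@retr R)}.
Proof.
by move=> /is_diff_retr y0; apply: differentiable_continuous;
  exact: is_diff_ex y0.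
Qed.

Lemma near_neq0 y : y != 0 -> \forall z \near y, z != 0.
Proof.
move=> y0; have : \forall z \near y, 0 < enorm z.
  exact: (@continuous_enorm R y _ (lt_nbhsr (enorm_gt0 y0))).
apply: filterS => z /=; rewrite /enorm => z0; apply/negP => /eqP ze.
by move: z0; rewrite ze dotE !mxE !mul0r !addr0 sqrtr0 ltxx.
Qed.

(** Smoothness on S^3 is local extendability, and the local extensions agree
    with Y only on S^3.  After composition with the radial projection they agree
    on open sets of R^4, so that Y o retr is as smooth as they are.  Only class
    C^1 is recorded. *)
Lemma smooth_S3_C1 (W : normedModType R) (Y : 'rV[R]_4 -> W) y :
  smooth_S3 Y -> y != 0 ->
  (\forall z \near y, differentiable (Y \o @retr R) z) /\
  forall v, {for y, continuous (fun z => 'd (Y \o @retr R) z v)}.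
Proof.
move=> sY y0; have [U [F [oU Uy CF FY]]] := sY _ (retr_S3 y0).
have [dF cdF] := CF 1%N.
have nU : \forall z \near y, z != 0 /\ U (retr z).
  near=> z; split; near: z; first exact: near_neq0.
  by apply: continuous_retr => //; exact: open_nbhs_nbhs.
have nFY : \forall z \near y, {near z, F \o @retr R =1 Y \o @retr R}.
  apply: filterS (near_join nU) => z; apply: filterS => t [t0 Ut] /=.
  by apply: FY => //; exact: retr_S3.
have nd : \forall z \near y, is_diff z (F \o @retr R)
    (fun v => (enorm z)^-1 *: 'd F (retr z) (tproj (retr z) v)).
  apply: filterS nU => z [z0 Uz].
  by apply: is_diff_retr_comp => //; exact: dF.
split.
  apply: filterS2 nFY nd => z zFY [dz _]; exact: near_eq_differentiable zFY dz.
move=> v.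
(* 'd F is only known to be continuous in the base point for fixed vectors,
   hence the expansion in the canonical basis *)
pose psi z i := tproj (retr z) v 0 i.
have nE : \forall z \near y,
    (enorm z)^-1 *: (\sum_i psi z i *: 'd F (retr z) 'e_i) =
    'd (Y \o @retr R) z v.
  apply: filterS2 nFY nd => z zFY [dz dE].
  have E1 := congr1 (@^~ v) (near_eq_diff zFY dz).
  have E2 := congr1 (@^~ v) dE.
  apply: (etrans _ (esym (etrans E1 E2))).
  congr (_ *: _).
  have -> : tproj (retr z) v = \sum_i psi z i *: 'e_i by exact: row_sum_delta.
  rewrite linear_sum; apply: eq_bigr => i _.
  by rewrite linearZ.
have cr := continuous_retr y0.
have cpsi i : {for y, continuous (psi ^~ i)}.
  have ci j : {for y, continuous (fun z => retr z 0 j)}.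
    apply: (@continuous_comp _ _ _ (@retr R) (fun t => t 0 j)) => //.
    exact: coord_continuous.
  have cdot : {for y, continuous (fun z => dot (retr z) v)}.
    apply: (@continuous_comp _ _ _ (@retr R) (fun t => dot t v)) => //.
    exact/differentiable_continuous/(is_diff_ex (is_diff_dotl _ _)).
  have -> : psi ^~ i = fun z => v 0 i - dot (retr z) v * retr z 0 i.
    by apply/funext => z; rewrite /psi !mxE.
  exact: (cvgB (cvg_cst (v 0 i)) (cvgM cdot (ci i))).
have cF i : {for y, continuous (fun z => 'd F (retr z) 'e_i)}.
  exact: (@continuous_comp _ _ _ (@retr R) (fun t => 'd F t 'e_i) y cr
    (cdF _ _ Uy)).
have cI : {for y, continuous (fun z => (enorm z)^-1)}.
  exact: (cvgV (lt0r_neq0 (enorm_gt0 y0)) (@continuous_enorm R y)).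
have cS : {for y, continuous (fun z => \sum_i psi z i *: 'd F (retr z) 'e_i)}.
  apply: (@cvg_big _ _ _ _ _ add_continuous _ _ _
    (fun i z => psi z i *: 'd F (retr z) 'e_i)) => [|i _].
    exact: nbhs_filter.
  exact: (cvgZ (cpsi i) (cF i)).
have cG : {for y, continuous (fun z =>
    (enorm z)^-1 *: \sum_i psi z i *: 'd F (retr z) 'e_i)}.
  exact: (cvgZ cI cS).
exact: (near_eq_continuous nE cG).
Unshelve. all: by end_near.
Qed.

End SmoothFields.

Section Beltrami.
Context {R : realType}.
Implicit Types (x y u v w a b : 'rV[R]_4).

Variable Y : 'rV[R]_4 -> 'rV[R]_4.
Hypothesis sY : smooth_S3 Y.
Let G := Y \o @retr R.

Lemma differentiable_ext y : y != 0 -> differentiable G y.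
Proof. by move=> /(smooth_S3_C1 sY)[dG _]; exact: (nbhs_singleton dG). Qed.

Lemma diff_ext_radial y : y != 0 -> 'd G y y = 0.
Proof.
move=> y0; rewrite -deriveE; last exact: differentiable_ext.
apply/lim_near_cst => //=; near=> h.
have -> : h *: y + y = (1 + h) *: y by rewrite scalerDl scale1r addrC.
rewrite /G /= retrZ ?subrr ?scaler0//.
have : `|h| < 1 by near: h; exact: dnbhs0_lt.
by rewrite ltr_norml => /andP[]; lra.
Unshelve. all: by end_near. Qed.

Lemma diff_ext_scale k y v : 0 < k -> y != 0 ->
  'd G (k *: y) v = k^-1 *: 'd G y v.
Proof.
move=> k0 y0.
have ky0 : k *: y != 0 by rewrite scaler_eq0 negb_or y0 gt_eqF.
have GE : G \o *:%R k = G by apply/funext => z; rewrite /G /= retrZ.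
have H := is_diff_comp (is_diff_scaler k y)
  (differentiableP (differentiable_ext ky0)).
have E : 'd G y v = 'd G (k *: y) (k *: v).
  by have := is_diff_val v H; rewrite GE.
apply: (etrans _ (esym (congr1 ( *:%R k^-1) E))).
by rewrite linearZ scalerA mulVf ?scale1r// gt_eqF.
Qed.

Lemma derive_dot_ext y v b : y != 0 ->
  'D_v (fun z => dot (G z) b) y = dot ('d G y v) b.
Proof.
move=> y0.
have H := is_diff_comp (differentiableP (differentiable_ext y0))
  (is_diff_dotl b (G y)).
rewrite deriveE; last exact: (is_diff_ex H).
exact: (is_diff_val v H).
Qed.

Hypothesis tY : forall x, S3 x -> tangent x (Y x).

(** Differentiate the identity dot (G z) z = 0. *)
Lemma diff_ext_normal x v : S3 x -> dot ('d G x v) x = - dot (Y x) v.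
Proof.
move=> xS; have x0 := S3_neq0 xS.
have H := is_diff_dot (differentiableP (differentiable_ext x0))
  (is_diff_id x).
have dot0 : \forall z \near x, dot (G z) z = 0.
  apply: filterS (near_neq0 x0) => z z0; rewrite -[X in dot _ X](scale1r z).
  rewrite -[1](mulfV (lt0r_neq0 (enorm_gt0 z0))) -scalerA dotZr /G /= dotC.
  by rewrite [dot _ _](tY (retr_S3 z0)) mulr0.
have near0 : {near x, (fun z => dot (G z) z : R) =1 cst 0}.
  exact: filterS dot0.
have E := near_eq_diff near0 (is_diff_ex H).
have := etrans (congr1 (@^~ v) E) (is_diff_val v H).
by rewrite diff_cst /G /= retr_id// => /esym/eqP; rewrite addr_eq0 => /eqP.
Qed.

Variable f : 'rV[R]_4 -> R.
Hypothesis cY : is_curl Y (fun x => f x *: Y x).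

(** For tangent a and b this is the equation d(Y^flat) = f iota_Y mu.  The other
    terms come from the normal components of a and b: G is constant along the
    normal direction, and the normal component of its derivatives is given by
    [diff_ext_normal]. *)
Lemma curl_ext x a b : S3 x ->
  dot ('d G x a) b - dot ('d G x b) a =
  f x * vol x (Y x) a b - dot x b * dot (Y x) a + dot x a * dot (Y x) b.
Proof.
move=> xS; have x0 := S3_neq0 xS.
have tt c : tangent x (tproj x c).
  by rewrite /tangent /tproj dotBr dotZr; move/S3P: xS => ->; ring.
have [_ /(_ _ _ (tt a) (tt b))] := cY xS.
rewrite vol_scale vol_tproj /ext_d /tderiv.
have flatE c : ((fun y => flat Y y c) : 'rV[R]_4 -> R^o) \o @retr R =
    (fun z => dot (G z) c) by [].
rewrite !flatE !derive_dot_ext// => ->.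
have dG c : 'd G x (tproj x c) = 'd G x c.
  by rewrite /tproj linearB linearZ /= (diff_ext_radial x0) scaler0 subr0.
rewrite !dG /tproj !dotBr !dotZr !diff_ext_normal//.
by ring.
Qed.

(** The points found by [discrete_green] have curl at least c: around any other
    point all small cells have a discrete curl below c. *)
Lemma strict_curl_lt y a b c : y != 0 ->
  dot ('d G y a) b - dot ('d G y b) a < c ->
  \forall z \near y & h \near 0^'+,
    (dot (G (z + h *: a)) b - dot (G z) b) -
    (dot (G (z + h *: b)) a - dot (G z) a) < c * h.
Proof.
move=> y0 H.
have C1 v w : (\forall z \near y, derivable (fun z => dot (G z) w : R) z v) /\
    {for y, continuous ('D_v (fun z => dot (G z) w : R))}.
  split.
    apply: filterS (near_neq0 y0) => z z0; apply: diff_derivable.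
    have H' := is_diff_comp (differentiableP (differentiable_ext z0))
      (is_diff_dotl w (G z)).
    exact: (is_diff_ex H').
  apply: (@near_eq_continuous _ _ (fun z => dot ('d G z v) w)).
    by apply: filterS (near_neq0 y0) => z z0; rewrite derive_dot_ext.
  have [_ cG] := smooth_S3_C1 sY y0.
  apply: (@continuous_comp _ _ _ (fun z => 'd G z v) (fun t => dot t w)).
    exact: cG.
  exact/differentiable_continuous/(is_diff_ex (is_diff_dotl _ _)).
pose d := (c - (dot ('d G y a) b - dot ('d G y b) a)) / 2.
have d0 : 0 < d by rewrite divr_gt0// subr_gt0.
have [Dab Cab] := C1 a b; have [Dba Cba] := C1 b a.
have S1 : \forall z \near y & h \near 0^'+,
    dot (G (z + h *: a)) b - dot (G z) b < (dot ('d G y a) b + d) * h.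
  apply: (strict_derive_lt Dab Cab).
  by rewrite derive_dot_ext// ltrDl.
have S2 : \forall z \near y & h \near 0^'+,
    - dot (G (z + h *: b)) a - - dot (G z) a < (- dot ('d G y b) a + d) * h.
  apply: (@strict_derive_lt _ _ (fun z => - dot (G z) a)).
  - by apply: filterS Dba => z; exact: derivableN.
  - apply: (@near_eq_continuous _ _
      (fun z => - 'D_b (fun z => dot (G z) a : R) z)).
      by apply: filterS Dba => z dz; rewrite deriveN.
    exact: cvgN Cba.
  - rewrite deriveN; last exact: (nbhs_singleton Dba).
    by rewrite derive_dot_ext// ltrDl.
apply: filterS2 S1 S2 => -[z h] /= H1 H2.
have : c * h = (dot ('d G y a) b + d) * h + (- dot ('d G y b) a + d) * h.
  by rewrite /d; field.
by move=> ->; lra.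
Qed.

Variables o a b : 'rV[R]_4.
Hypotheses (oo : dot o o = 1) (aa : dot a a = 1) (bb : dot b b = 1).
Hypotheses (oa : dot o a = 0) (ob : dot o b = 0) (ab : dot a b = 0).
Let y (s t : R) := o + s *: a + t *: b.
Let x (s t : R) := retr (y s t).
Let e : R := 1 / 4.

(** Green's inequality on the square o + s a + t b.  On its boundary Y turns
    from a to b at least as fast as a field of curl 1, hence the curl of G is at
    least 1 at some point.  The terms of order zero of [curl_ext] are at most
    2 * (1/4) * (1/2), too small to account for this: the volume term is
    positive. *)
Lemma beltrami_square :
  (forall s t, -e <= s <= e -> -e <= t <= e -> `|dot (Y (x s t)) a| <= 1 / 2) ->
  (forall s t, -e <= s <= e -> -e <= t <= e -> `|dot (Y (x s t)) b| <= 1 / 2) ->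
  (forall t, -e <= t <= e -> e <= dot (Y (x e t)) b - dot (Y (x (- e) t)) b) ->
  (forall s, -e <= s <= e -> e <= dot (Y (x s (- e))) a - dot (Y (x s e)) a) ->
  exists s t, [/\ -e <= s <= e, -e <= t <= e &
    0 < f (x s t) * vol (x s t) (Y (x s t)) a b].
Proof.
move=> Ya Yb HQ HP.
have e0 : 0 < e by rewrite /e; lra.
have [| |s [t [se te nlt]]] := @discrete_green R (fun s t => dot (G (y s t)) a)
  (fun s t => dot (G (y s t)) b) e 1 e0.
- by move=> t te; rewrite mul1r; exact: HQ.
- by move=> s se; rewrite mul1r; exact: HP.
exists s, t; split => //.
have yy : dot (y s t) (y s t) = 1 + s ^+ 2 + t ^+ 2.
  rewrite /y !dotDl !dotDr !dotZl !dotZr (dotC a o) (dotC b o) (dotC b a).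
  by rewrite oo aa bb oa ob ab; ring.
have y0 : y s t != 0 by rewrite -dot_eq0 yy; nra.
set r := enorm (y s t).
have r0 : 0 < r := enorm_gt0 y0.
have r1 : 1 <= r.
  have := enorm_sqr (y s t); rewrite yy -/r => rr.
  by nra.
have yE : y s t = r *: x s t.
  by rewrite /x /retr scalerA mulfV ?scale1r// gt_eqF.
have xS : S3 (x s t) by exact: retr_S3.
have xa : dot (x s t) a = s / r.
  rewrite /x /retr dotZl /y !dotDl !dotZl aa oa (dotC b a) ab -/(y s t) -/r.
  by field; rewrite gt_eqF.
have xb : dot (x s t) b = t / r.
  rewrite /x /retr dotZl /y !dotDl !dotZl bb ob ab -/(y s t) -/r.
  by field; rewrite gt_eqF.
have curl1 : 1 <= dot ('d G (y s t) a) b - dot ('d G (y s t) b) a.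
  rewrite leNgt; apply/negP => /(strict_curl_lt y0) [[U Z] /= [Uy Z0] UZ].
  apply: nlt; exists ((fun p : R * R => y p.1 p.2) @^-1` U, Z) => /=.
    split=> //.
    have : {for (s, t), continuous (fun p : R * R => y p.1 p.2)}.
      apply: cvgD; [apply: cvgD; [exact: cvg_cst|]|];
        by apply: cvgZr_tmp; first [exact: cvg_fst|exact: cvg_snd].
    by apply.
  move=> [[s' t'] h] /= [Uy' Zh].
  have := UZ (y s' t', h) (conj Uy' Zh) => /=.
  rewrite mul1r.
  have -> : y s' t' + h *: a = y (s' + h) t'.
    by rewrite /y scalerDl addrAC !addrA.
  by have -> : y s' t' + h *: b = y s' (t' + h) by rewrite /y scalerDl !addrA.
have dE v : 'd G (y s t) v = r^-1 *: 'd G (x s t) v.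
  by have := diff_ext_scale v r0 (S3_neq0 xS); rewrite -yE.
have curlE : dot ('d G (y s t) a) b - dot ('d G (y s t) b) a =
    r^-1 * (dot ('d G (x s t) a) b - dot ('d G (x s t) b) a).
  rewrite mulrBr -!dotZl.
  by congr (dot _ _ - dot _ _); exact: dE.
move: curl1; rewrite {}curlE.
have xcurl := curl_ext a b xS.
rewrite xcurl xa xb.
have := Ya s t se te; have := Yb s t se te; rewrite !ler_norml.
move: se te; rewrite /e.
set A := dot (Y _) a; set B := dot (Y _) b; set F := f _ * _.
move=> /andP[s1 s2] /andP[t1 t2] /andP[B1 B2] /andP[A1 A2].
rewrite mulrC ler_pdivlMr// mul1r => H.
have bnd (p q : R) : - (1 / 4) <= p <= 1 / 4 -> - (1 / 2) <= q <= 1 / 2 ->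
    - (1 / 8) <= p / r * q <= 1 / 8.
  move=> /andP[p1 p2] /andP[q1 q2].
  have p3 : - (1 / 4) <= p / r by rewrite ler_pdivlMr//; nra.
  have p4 : p / r <= 1 / 4 by rewrite ler_pdivrMr//; nra.
  by apply/andP; split; nra.
have := bnd s B; have := bnd t A.
rewrite s1 s2 t1 t2 A1 A2 B1 B2.
move=> /(_ isT isT)/andP[h1 h2] /(_ isT isT)/andP[h3 h4].
by lra.
Qed.

End Beltrami.

(** * Polynomial maps are smooth *)

Section Polynomial.
Context {R : realType}.

(** A class of differentiable maps that is stable under differentiation along
    fixed vectors consists of maps of class C^k for every k.  Polynomial maps
    form such a class. *)
Inductive polyfun : ('rV[R]_4 -> R) -> Prop :=
| polyfun_cst c : polyfun (cst c)
| polyfun_coord i : polyfun (fun y => y 0 i)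
| polyfun_add f g : polyfun f -> polyfun g -> polyfun (f + g)
| polyfun_mul f g : polyfun f -> polyfun g -> polyfun (f * g).

Inductive polymap (W : normedModType R) : ('rV[R]_4 -> W) -> Prop :=
| polymap_scale f w : polyfun f -> polymap (fun y => f y *: w)
| polymap_add F G : polymap F -> polymap G -> polymap (F + G).

Lemma polyfun_diff f : polyfun f ->
  (forall x, differentiable f x) /\ forall v, polyfun (fun x => 'd f x v).
Proof.
elim=> [c|i|{}f g _ [df pf] _ [dg pg]|{}f g fP [df pf] gP [dg pg]].
- split=> [x|v]; first exact: differentiable_cst.
  have -> : (fun x => 'd (cst c : 'rV[R]_4 -> R) x v) = cst 0.
    by apply/funext => x; rewrite diff_cst.
  exact: polyfun_cst.
- have H x := @is_diff_coord R 3 x i.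
  split=> [x|v]; first by have [] := H x.
  have -> : (fun x => 'd (fun y : 'rV[R]_4 => y 0 i : R) x v) = cst (v 0 i).
    by apply/funext => x; exact: (is_diff_val v (H x)).
  exact: polyfun_cst.
- split=> [x|v]; first exact: differentiableD.
  have -> : (fun x => 'd (f + g) x v) =
      (fun x => 'd f x v) + (fun x => 'd g x v).
    by apply/funext => x; exact: (congr1 (@^~ v) (diffD (df _) (dg _))).
  exact: (polyfun_add (pf v) (pg v)).
- split=> [x|v]; first exact: differentiableM.
  have -> : (fun x => 'd (f * g) x v) =
      f * (fun x => 'd g x v) + g * (fun x => 'd f x v).
    by apply/funext => x; exact: (congr1 (@^~ v) (diffM (df _) (dg _))).
  exact: (polyfun_add (polyfun_mul fP (pg v)) (polyfun_mul gP (pf v))).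
Qed.

Lemma polymap_diff (W : normedModType R) (F : 'rV[R]_4 -> W) : polymap F ->
  (forall x, differentiable F x) /\ forall v, polymap (fun x => 'd F x v).
Proof.
elim=> [f w /polyfun_diff[df pf]|{}F G _ [dF pF] _ [dG pG]].
- split=> [x|v]; first exact: differentiableZl.
  have -> : (fun x => 'd (fun y => f y *: w) x v) = (fun x => 'd f x v *: w).
    by apply/funext => x; exact: (congr1 (@^~ v) (diffZl w (df _))).
  exact: polymap_scale.
- split=> [x|v]; first exact: differentiableD.
  have -> : (fun x => 'd (F + G) x v) =
      (fun x => 'd F x v) + (fun x => 'd G x v).
    by apply/funext => x; exact: (congr1 (@^~ v) (diffD (dF _) (dG _))).
  exact: (polymap_add (pF v) (pG v)).
Qed.

Lemma polymap_Ck (W : normedModType R) k (U : set 'rV[R]_4)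
    (F : 'rV[R]_4 -> W) :
  polymap F -> Ck_on k U F.
Proof.
elim: k F => [|k IHk] F /polymap_diff[dF pF] /=.
  by move=> x _; exact: differentiable_continuous.
by split=> [x _|v]; [exact: dF|exact: IHk].
Qed.

Lemma polymap_smooth (W : normedModType R) (F : 'rV[R]_4 -> W) :
  polymap F -> smooth_S3 F.
Proof.
move=> pF x _; exists setT, F; split=> //; first exact: openT.
by move=> k; exact: polymap_Ck.
Qed.

End Polynomial.

(** * The stationary solution *)

Section Shear.
Context {R : realType}.
Implicit Types (x v : 'rV[R]_4).

(** |z2|^2 *)
Definition sqz2 x : R := x 0 2 ^+ 2 + x 0 3 ^+ 2.

Definition speed x : R := 2 * sqz2 x - 1.

(** (i z1, b i z2), with b the function speed *)
Definition shear x : 'rV[R]_4 :=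
  \row_j [:: - x 0 1; x 0 0; - (speed x * x 0 3); speed x * x 0 2]`_j.

Definition dshear x v : 'rV[R]_4 :=
  let dspeed := 4 * (x 0 2 * v 0 2 + x 0 3 * v 0 3) in
  \row_j [:: - v 0 1; v 0 0; - (speed x * v 0 3 + dspeed * x 0 3);
             speed x * v 0 2 + dspeed * x 0 2]`_j.

(** nabla_X X is minus the tangential part of (b^2 - 1) z2, by [dshear_shear];
    with t = |z2|^2, b^2 - 1 = 4 t^2 - 4 t, and the tangential part of z2 is
    half the gradient of t.  So the pressure is a primitive of 2 t^2 - 2 t. *)
Definition pressure x : R := 2 / 3 * sqz2 x ^+ 3 - sqz2 x ^+ 2.

Lemma shear0 x : shear x 0 0 = - x 0 1. Proof. by rewrite mxE. Qed.
Lemma shear1 x : shear x 0 1 = x 0 0. Proof. by rewrite mxE. Qed.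
Lemma shear2 x : shear x 0 2 = - (speed x * x 0 3). Proof. by rewrite mxE. Qed.
Lemma shear3 x : shear x 0 3 = speed x * x 0 2. Proof. by rewrite mxE. Qed.
Definition shearE := (shear0, shear1, shear2, shear3).

Lemma polyfun_sqz2 : polyfun sqz2.
Proof.
have -> : sqz2 = (fun y : 'rV[R]_4 => y 0 2) * (fun y : 'rV[R]_4 => y 0 2) +
  (fun y : 'rV[R]_4 => y 0 3) * (fun y : 'rV[R]_4 => y 0 3) by [].
by apply: polyfun_add; apply: polyfun_mul; exact: polyfun_coord.
Qed.

Lemma polyfun_speed : polyfun speed.
Proof.
have -> : speed = cst 2 * sqz2 + cst (-1) by [].
apply: polyfun_add; last exact: polyfun_cst.
by apply: polyfun_mul; [exact: polyfun_cst|exact: polyfun_sqz2].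
Qed.

Lemma is_diff_sqz2 x :
  is_diff x sqz2 (fun v => 2 * (x 0 2 * v 0 2 + x 0 3 * v 0 3)).
Proof.
have H i := @is_diff_coord R 3 x i.
apply: (is_diff_eq
  (is_diffD (is_diffM (H 2) (H 2)) (is_diffM (H 3) (H 3)))).
by apply/funext => v; rewrite !fctE /GRing.scale /=; ring.
Qed.

Lemma is_diff_speed x :
  is_diff x speed (fun v => 4 * (x 0 2 * v 0 2 + x 0 3 * v 0 3)).
Proof.
have -> : speed = 2 *: sqz2 - cst 1 by [].
have H := is_diff_sqz2 x.
apply: is_diff_eq; rewrite subr0.
by apply/funext => v; rewrite !fctE /GRing.scale /=; ring.
Qed.

Lemma is_diff_shear x : is_diff x shear (dshear x).
Proof.
have H i := @is_diff_coord R 3 x i.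
have Hb := is_diff_speed x.
pose c i := fun y : 'rV[R]_4 => y 0 i : R.
apply: is_diff_row; apply: ord4P.
- have -> : (fun y => shear y 0 0) = - c 1 by apply/funext => y; rewrite shear0.
  by apply: is_diff_eq; apply/funext => v; rewrite mxE.
- have -> : (fun y => shear y 0 1) = c 0 by apply/funext => y; rewrite shear1.
  by apply: is_diff_eq; apply/funext => v; rewrite mxE.
- have -> : (fun y => shear y 0 2) = - (speed * c 3).
    by apply/funext => y; rewrite shear2.
  apply: is_diff_eq; apply/funext => v; rewrite mxE !fctE /c /GRing.scale /=.
  by ring.
- have -> : (fun y => shear y 0 3) = speed * c 2.
    by apply/funext => y; rewrite shear3.
  apply: is_diff_eq; apply/funext => v; rewrite mxE !fctE /c /GRing.scale /=.
  by ring.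
Qed.

Lemma is_diff_pressure x : is_diff x pressure
  (fun v => (4 * sqz2 x ^+ 2 - 4 * sqz2 x) * (x 0 2 * v 0 2 + x 0 3 * v 0 3)).
Proof.
have H := is_diff_sqz2 x.
have -> : pressure = (2 / 3) *: sqz2 ^+ 3 - sqz2 ^+ 2.
  by apply/funext => y; rewrite !fctE.
by apply: is_diff_eq; apply/funext => v; rewrite !fctE /GRing.scale /=; field.
Qed.

Lemma smooth_shear : smooth_S3 shear.
Proof.
apply: polymap_smooth.
pose c i := fun y : 'rV[R]_4 => y 0 i : R.
have pc i : polyfun (c i) by exact: polyfun_coord.
have -> : shear =
  (fun y => c 1 y *: (- 'e_0)) + (fun y => c 0 y *: 'e_1) +
  (fun y => (speed * c 3) y *: (- 'e_2)) + (fun y => (speed * c 2) y *: 'e_3).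
  apply/funext => y; rewrite [LHS]row_sum_delta big_ord4 !shearE.
  by rewrite !fctE /c !scalerN !scaleNr.
have ps := polyfun_speed.
by do !apply: polymap_add; apply: polymap_scale => //; exact: polyfun_mul.
Qed.

Lemma smooth_pressure : smooth_S3 (pressure : _ -> R^o).
Proof.
apply: polymap_smooth.
have -> : (pressure : _ -> R^o) =
    (fun y => (cst (2 / 3) * (sqz2 * sqz2 * sqz2) +
               cst (-1) * (sqz2 * sqz2)) y *: (1 : R^o)).
  by apply/funext => y; rewrite /pressure !fctE /GRing.scale /=; ring.
have pt := polyfun_sqz2.
apply: polymap_scale; apply: polyfun_add; apply: polyfun_mul;
  by [exact: polyfun_cst|do ?apply: polyfun_mul].
Qed.

Lemma tangent_shear x : tangent x (shear x).
Proof. by rewrite /tangent dotE !shearE; ring. Qed.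

Lemma shear_neq0 : non_vanishing shear.
Proof.
move=> x /S3P xx; apply/eqP => /rowP e0.
have := (e0 0, e0 1, e0 2, e0 3); rewrite !shearE !mxE => -[[[h1 h0] h2] h3].
have {}h1 : x 0 1 = 0 by lra.
have z2_1 : sqz2 x = 1 by move: xx; rewrite dotE h1 h0 /sqz2 => xx; nra.
move: h2 h3; rewrite /speed z2_1 => h2 h3.
have x3 : x 0 3 = 0 by lra.
have x2 : x 0 2 = 0 by lra.
move: z2_1; rewrite /sqz2 x2 x3 expr0n /= addr0 => /esym/eqP.
by rewrite oner_eq0.
Qed.

Lemma tproj_tangent x v : tangent x v -> tproj x v = v.
Proof. by rewrite /tangent /tproj => ->; rewrite scale0r subr0. Qed.

Lemma tangent_tproj x v : S3 x -> tangent x (tproj x v).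
Proof.
by move=> /S3P xx; rewrite /tangent /tproj dotBr dotZr xx; ring.
Qed.

Lemma nabla_shear x v : S3 x -> tangent x v ->
  nabla shear x v = tproj x (dshear x v).
Proof.
move=> xS xv; have [dX dXE] := is_diff_shear x.
rewrite /nabla (tderivE v xS dX) (tproj_tangent xv); congr (tproj x _).
exact: (congr1 (@^~ v) dXE).
Qed.

Lemma dshear0 x v : dshear x v 0 0 = - v 0 1. Proof. by rewrite mxE. Qed.
Lemma dshear1 x v : dshear x v 0 1 = v 0 0. Proof. by rewrite mxE. Qed.
Lemma dshear2 x v : dshear x v 0 2 = - (speed x * v 0 3 +
  4 * (x 0 2 * v 0 2 + x 0 3 * v 0 3) * x 0 3). Proof. by rewrite mxE. Qed.
Lemma dshear3 x v : dshear x v 0 3 = speed x * v 0 2 +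
  4 * (x 0 2 * v 0 2 + x 0 3 * v 0 3) * x 0 2. Proof. by rewrite mxE. Qed.
Definition dshearE := (dshear0, dshear1, dshear2, dshear3).

Lemma entryB (v w : 'rV[R]_4) k i : (v - k *: w) 0 i = v 0 i - k * w 0 i.
Proof. by rewrite !mxE. Qed.

Lemma dshearB x v w (k : R) :
  dshear x (v - k *: w) = dshear x v - k *: dshear x w.
Proof.
by apply/rowP; apply: ord4P; rewrite !(entryB, dshearE); ring.
Qed.

Lemma dot_dshear x v : dot x (dshear x v) =
  x 0 1 * v 0 0 - x 0 0 * v 0 1 + speed x * (x 0 3 * v 0 2 - x 0 2 * v 0 3).
Proof. by rewrite dotE !dshearE; ring. Qed.

(** The divergence is the trace of dX on R^4 minus its normal part x . dX(x).
    The former is zero because X is a rotation in each plane, with a speed that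
    is constant along the rotation; the latter is zero by [dot_dshear]. *)
Lemma divergence_shear x : S3 x -> divergence shear x = 0.
Proof.
move=> xS.
have d (i j : 'I_4) : ('e_i : 'rV[R]_4) 0 j = (i == j)%:R.
  by rewrite mxE eqxx /= eq_sym.
have term i : dot 'e_i (nabla shear x (tproj x 'e_i)) =
    dshear x 'e_i 0 i - x 0 i * dshear x x 0 i
    - (dot x (dshear x 'e_i) - x 0 i * dot x (dshear x x)) * x 0 i.
  rewrite nabla_shear//; last exact: tangent_tproj.
  rewrite dotC dot_delta /tproj dot_delta dshearB dotBr dotZr.
  by rewrite !entryB.
rewrite /divergence big_ord4 !term !dot_dshear !dshearE.
rewrite !d /=; ring.
Qed.

Lemma div_free_shear : div_free_field shear.
Proof.
split; last exact: divergence_shear.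
by split; [exact: smooth_shear|move=> x _; exact: tangent_shear].
Qed.

(** X preserves b, so only the rotations contribute: the ambient derivative of X
    along itself is - (z1, b^2 z2) = - x - (b^2 - 1) z2. *)
Lemma dshear_shear x : dshear x (shear x) =
  - 1 *: x -
  (4 * sqz2 x ^+ 2 - 4 * sqz2 x) *: \row_j [:: 0; 0; x 0 2; x 0 3]`_j.
Proof.
apply/rowP; apply: ord4P; rewrite entryB dshearE !shearE !mxE /=.
all: by rewrite /speed /sqz2; ring.
Qed.

Lemma stationary_shear : stationary_euler shear.
Proof.
split; first exact: div_free_shear.
pose z x : 'rV[R]_4 := \row_j [:: 0; 0; x 0 2; x 0 3]`_j.
pose k x := 4 * sqz2 x ^+ 2 - 4 * sqz2 x.
exists pressure, (fun x => tproj x (k x *: z x)); split.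
- exact: smooth_pressure.
- move=> x xS; split=> [|v xv]; first exact: tangent_tproj.
  have [dp dpE] := is_diff_pressure x.
  rewrite (tderivE v xS dp) (tproj_tangent xv).
  apply: (etrans _ (esym (congr1 (@^~ v) dpE))).
  rewrite /tproj -scaleNr dotDl !dotZl [dot x v]xv mulr0 addr0 -/(k x).
  by rewrite dotE !mxE /=; ring.
- move=> x xS; rewrite nabla_shear//; last exact: tangent_shear.
  rewrite dshear_shear -/(k x) -/(z x).
  move/S3P: xS => xx; rewrite /tproj !dotBr !dotZr xx.
  apply/rowP => i; rewrite !mxE.
  by ring.
Qed.

End Shear.

(** * The sign of the proportionality factor *)

Section Conclusion.
Context {R : realType}.
Implicit Types (x y u v : 'rV[R]_4).

(** Intermediate values along the radial projection of the segment from x to y.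
    The hypothesis on x0 + x2 keeps this segment away from the origin, and holds
    near the base points (1, 0) and (0, 1) of the two squares. *)
Lemma factor_keeps_sign (f : 'rV[R]_4 -> R) x y :
  smooth_S3 (f : _ -> R^o) -> (forall z, S3 z -> f z != 0) ->
  S3 x -> S3 y -> 0 < x 0 0 + x 0 2 -> 0 < y 0 0 + y 0 2 ->
  0 < f x -> 0 < f y.
Proof.
move=> sf f0 xS yS xh yh fx; rewrite ltNge; apply/negP => fy.
pose g (l : R) := x + l *: (y - x).
have g0 l : 0 <= l <= 1 -> g l != 0.
  move=> /andP[l0 l1]; apply/eqP => /rowP gE.
  have := (gE 0, gE 2); rewrite !mxE => -[E0 E2].
  have xl : 0 <= (1 - l) * (x 0 0 + x 0 2) by rewrite mulr_ge0 ?subr_ge0// ltW.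
  have yl : 0 <= l * (y 0 0 + y 0 2) by rewrite mulr_ge0// ltW.
  have [ll|ll] := ltP l (1 / 2).
    have : 0 < (1 - l) * (x 0 0 + x 0 2) by rewrite mulr_gt0// subr_gt0; lra.
    by lra.
  have : 0 < l * (y 0 0 + y 0 2) by rewrite mulr_gt0//; lra.
  by lra.
have cg l : {for l, continuous g}.
  by apply: cvgD; [exact: cvg_cst|apply: cvgZr_tmp; exact: cvg_id].
have cfg : {within `[0, 1], continuous (fun l => f (retr (g l)))}.
  apply/continuous_in_subspaceT => l; rewrite inE /= in_itv /= => l01.
  have [/nbhs_singleton df _] := smooth_S3_C1 sf (g0 l l01).
  apply: (@continuous_comp _ _ _ g (f \o @retr R)); first exact: cg.
  exact: (differentiable_continuous df).
have [] := @IVT R (fun l => f (retr (g l))) 0 1 0 ler01 cfg.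
  rewrite /g scale0r addr0 scale1r subrKC !retr_id//.
  by rewrite ge_min le_max fy (ltW fx) orbT.
move=> l; rewrite in_itv /= => l01 fl0.
by have /eqP := f0 _ (retr_S3 (g0 l l01)).
Qed.

Variables (Y : 'rV[R]_4 -> 'rV[R]_4) (f : 'rV[R]_4 -> R).
Hypotheses (YX : forall x, S3 x -> enorm (Y x - shear x) < 1 / 40)
  (sY : smooth_S3 Y) (tY : forall x, S3 x -> tangent x (Y x))
  (cY : is_curl Y (fun x => f x *: Y x)).

Lemma close_entry x i : S3 x ->
  shear x 0 i - 1 / 40 < Y x 0 i < shear x 0 i + 1 / 40.
Proof.
move=> /YX; have := coord_le_enorm (Y x - shear x) i; rewrite !mxE => H1 H2.
have := le_lt_trans H1 H2; rewrite ltr_norml => /andP[].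
by move=> *; apply/andP; split; lra.
Qed.

(** The bound 15/16 follows from 1 + 2/16 <= (16/15)^2. *)
Lemma retr_square y (s t : R) : dot y y = 1 + s ^+ 2 + t ^+ 2 ->
  - (1 / 4) <= s <= 1 / 4 -> - (1 / 4) <= t <= 1 / 4 ->
  exists q, [/\ 15 / 16 <= q, q <= 1, q ^+ 2 * (1 + s ^+ 2 + t ^+ 2) = 1,
    S3 (retr y) & forall i, retr y 0 i = q * y 0 i].
Proof.
move=> yy /andP[s1 s2] /andP[t1 t2].
have y0 : y != 0 by rewrite -dot_eq0 yy; nra.
have r0 := enorm_gt0 y0; have rr := enorm_sqr y.
have s3 : s ^+ 2 <= 1 / 16 by nra.
have t3 : t ^+ 2 <= 1 / 16 by nra.
have s4 := sqr_ge0 s; have t4 := sqr_ge0 t.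
have r1 : 1 <= enorm y by nra.
have r2 : enorm y <= 16 / 15 by nra.
exists (enorm y)^-1; split.
- by rewrite -[leLHS]invrK lef_pV2 ?posrE ?invr_gt0//; lra.
- by rewrite invf_le1.
- by rewrite -yy -rr; field; rewrite gt_eqF.
- exact: retr_S3.
- by move=> i; rewrite mxE.
Qed.

Lemma dot_e_e (i j : 'I_4) : dot ('e_i : 'rV[R]_4) 'e_j = (i == j)%:R.
Proof. by rewrite dot_delta mxE eqxx /= eq_sym. Qed.

Let axis (i j k : 'I_4) (s t : R) : 'rV[R]_4 := 'e_i + s *: 'e_j + t *: 'e_k.

Lemma axisE i j k s t l : axis i j k s t 0 l =
  (i == l)%:R + s * (j == l)%:R + t * (k == l)%:R.
Proof. by rewrite !mxE eqxx /= ![l == _]eq_sym. Qed.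

Lemma axis_sqr i j k s t : i != j -> i != k -> j != k ->
  dot (axis i j k s t) (axis i j k s t) = 1 + s ^+ 2 + t ^+ 2.
Proof.
move=> ij ik jk; rewrite /axis !dotDl !dotDr !dotZl !dotZr !dot_e_e !eqxx.
rewrite ![_ == i]eq_sym [k == j]eq_sym (negbTE ij) (negbTE ik) (negbTE jk) /=.
by ring.
Qed.

(** A field which is close to the rotation m (s e_k - t e_j) on the square based
    at e_i satisfies the boundary conditions of [beltrami_square]: the two sides
    differ by at least 2 * (7/10) * (1/4) - 2/40, which exceeds 1/4. *)
Lemma factor_sign_on_square i j k (p := fun s t => retr (axis i j k s t)) :
  i != j -> i != k -> j != k ->
  (forall s t, - (1 / 4) <= s <= 1 / 4 -> - (1 / 4) <= t <= 1 / 4 ->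
    exists m, [/\ 7 / 10 <= m, m <= 1,
      - (m * t) - 1 / 40 < Y (p s t) 0 j < - (m * t) + 1 / 40 &
      m * s - 1 / 40 < Y (p s t) 0 k < m * s + 1 / 40]) ->
  exists s t, [/\ - (1 / 4) <= s <= 1 / 4, - (1 / 4) <= t <= 1 / 4 &
    0 < f (p s t) * vol (p s t) (Y (p s t)) 'e_j 'e_k].
Proof.
move=> ij ik jk rot.
have e1 : - (1 / 4) <= (1 / 4 : R) <= 1 / 4 by apply/andP; split; lra.
have e2 : - (1 / 4) <= - (1 / 4 : R) <= 1 / 4 by apply/andP; split; lra.
apply: (beltrami_square sY tY cY); rewrite ?dot_e_e ?eqxx//.
- by rewrite (negbTE ij).
- by rewrite (negbTE ik).
- by rewrite (negbTE jk).
- move=> s t se te; rewrite dot_delta -/(axis i j k s t) -/(p s t).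
  have [m [m1 m2 /andP[a1 a2] _]] := rot s t se te.
  by rewrite ler_norml; move: te => /andP[t1 t2]; apply/andP; split; nra.
- move=> s t se te; rewrite dot_delta -/(axis i j k s t) -/(p s t).
  have [m [m1 m2 _ /andP[a1 a2]]] := rot s t se te.
  by rewrite ler_norml; move: se => /andP[s1 s2]; apply/andP; split; nra.
- move=> t te; rewrite !dot_delta -!/(axis i j k _ t) -!/(p _ t).
  have [m [m1 m2 _ /andP[a1 a2]]] := rot _ t e1 te.
  have [n [n1 n2 _ /andP[b1 b2]]] := rot _ t e2 te.
  by lra.
- move=> s se; rewrite !dot_delta -!/(axis i j k s _) -!/(p s _).
  have [m [m1 m2 /andP[a1 a2] _]] := rot s _ se e1.
  have [n [n1 n2 /andP[b1 b2] _]] := rot s _ se e2.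
  by lra.
Qed.

(** The square around the circle z1 = 0: it is based at e_2, along e_0 and e_1,
    and there X is close to (i z1, i z2). *)
Lemma factor_positive_somewhere :
  exists x, [/\ S3 x, 0 < x 0 0 + x 0 2 & 0 < f x].
Proof.
have Q s t := @retr_square (axis 2 0 1 s t) s t
  (@axis_sqr 2 0 1 s t isT isT isT).
have [//|//|//||s [t [se te]]] := @factor_sign_on_square 2 0 1.
  move=> s t se te; have [q [q1 q2 _ xS xE]] := Q s t se te.
  exists q; split=> //; first lra.
    by have := close_entry 0 xS; rewrite shearE xE axisE /= !mulr0 mulr1 !add0r.
  have := close_entry 1 xS.
  by rewrite shearE xE axisE /= !mulr0 mulr1 add0r addr0.
have [q [q1 q2 qq xS xE]] := Q s t se te.
have := close_entry 3 xS; rewrite vol01 shearE /speed /sqz2 !xE !axisE /=.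
set x := retr _ => /andP[h _] fvol.
exists x; split => //.
  by rewrite !xE !axisE /=; move: se => /andP[s1 s2]; nra.
have Y3 : 0 < Y x 0 3 by nra.
have qY : 0 < q * Y x 0 3 by rewrite mulr_gt0//; lra.
by move: fvol; rewrite !(mulr0, addr0, mulr1, mul0r, subr0) pmulr_lgt0.
Qed.

(** The square around the circle z2 = 0: there b is close to -1, so that X turns
    from e_3 to e_2, while (x, X, e_3, e_2) is a negative frame. *)
Lemma factor_negative_somewhere :
  exists x, [/\ S3 x, 0 < x 0 0 + x 0 2 & f x < 0].
Proof.
have Q s t := @retr_square (axis 0 3 2 s t) s t
  (@axis_sqr 0 3 2 s t isT isT isT).
have [//|//|//||s [t [se te]]] := @factor_sign_on_square 0 3 2.
  move=> s t se te; have [q [q1 q2 qq xS xE]] := Q s t se te.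
  have q3 : 225 / 256 <= q ^+ 2 by nra.
  have q4 : q ^+ 2 <= 1 by nra.
  (* the value of b, in the shape given by the coordinates of the square *)
  have sp : 2 * ((q * (0 + s * 0 + t * 1)) ^+ 2 +
      (q * (0 + s * 1 + t * 0)) ^+ 2) - 1 = 1 - 2 * q ^+ 2 by lra.
  exists ((2 * q ^+ 2 - 1) * q); split; [nra|nra| |].
    have := close_entry 3 xS; rewrite shearE /speed /sqz2 !xE !axisE /= sp.
    by move=> /andP[h1 h2]; apply/andP; split; lra.
  have := close_entry 2 xS; rewrite shearE /speed /sqz2 !xE !axisE /= sp.
  by move=> /andP[h1 h2]; apply/andP; split; lra.
have [q [q1 q2 qq xS xE]] := Q s t se te.
have := close_entry 1 xS; rewrite vol32 shearE !xE !axisE /=.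
set x := retr _ => /andP[h _] fvol.
exists x; split => //.
  by rewrite !xE !axisE /=; move: te => /andP[t1 t2]; nra.
have Y1 : 0 < Y x 0 1 by nra.
have qY : 0 < q * Y x 0 1 by rewrite mulr_gt0//; lra.
move: fvol; rewrite !(mulr0, addr0, mulr1, mul0r, subr0) mulrN oppr_gt0.
by rewrite pmulr_llt0.
Qed.

Hypotheses (sf : smooth_S3 (f : _ -> R^o)) (f0 : forall x, S3 x -> f x != 0).

Lemma close_to_shear_not_beltrami : False.
Proof.
have [x [xS xh fx]] := factor_positive_somewhere.
have [y [yS yh fy]] := factor_negative_somewhere.
by have := factor_keeps_sign sf f0 xS yS xh yh fx; rewrite ltNge (ltW fy).
Qed.

End Conclusion.

Theorem corollary24 (R : realType) :
  exists X : 'rV[R]_4 -> 'rV[R]_4,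
    stationary_euler X /\ non_vanishing X /\
    exists N : set ('rV[R]_4 -> 'rV[R]_4),
      C0_nbhd X N /\ forall Y, N Y -> ~ rotational_beltrami Y.
Proof.
exists shear; split; first exact: stationary_shear.
split; first exact: shear_neq0.
exists [set Y | div_free_field Y /\
  forall x, S3 x -> enorm (Y x - shear x) < 1 / 40]; split.
  split; first by move=> Y [].
  by exists (1 / 40); first lra.
move=> Y [[[sY tY] _] YX] [_ [f [sf f0 cY]]].
exact: (close_to_shear_not_beltrami YX sY tY cY sf f0).
Qed.
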